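(* Let $n\ge 2$ be an integer and let $G_n$ be the group of the $n$-order two-dimensional magic cube. Then $$|G_n|=\begin{cases}(n^2)!/2, & n\equiv 1 \pmod 2,\\ (n^2)!, & n\equiv 0 \pmod 2.\end{cases}$$
   Context: Let $B_n=\{1,2,\dots,n^2\}$ be the set of positions of an $n\times n$ board, where the position in row $x$ and column $y$ ($1\le x,y\le n$) has number $\varphi(x,y)=n(x-1)+y$. Permutations act on the right and are composed from left to right. For $1\le i\le n$ and $j\in\mathbb{Z}$ define the permutations of $B_n$ $$V_i^j=\bigl(\varphi(n,i)\ \varphi(n-1,i)\ \cdots\ \varphi(1,i)\bigr)^j,\qquad H_i^j=\bigl(\varphi(i,n)\ \varphi(i,n-1)\ \cdots\ \varphi(i,1)\bigr)^j,$$ i.e. cyclic shifts by $j$ steps of column $i$ (upwards) and of row $i$ (leftwards). $G_n$ is the set of all permutations of $B_n$ that are finite compositions of the $V_i^j$ and $H_i^j$; it is a group under composition. *)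

(* Defs.v *)
From mathcomp Require Import all_boot all_fingroup all_algebra.

Set Implicit Arguments.
Unset Strict Implicit.
Unset Printing Implicit Defensive.

(* The permutation with cycle notation (s_1 s_2 ... s_k): s_1 |-> s_2, ...,
   s_k |-> s_1, every point outside s being fixed. *)
Definition cycle_perm (T : finType) (s : seq T) (Us : uniq s) : {perm T} :=
  perm (can_inj (prev_next Us)).

Definition zexpg (gT : finGroupType) (g : gT) (j : int) : gT :=
  match j with Posz m => (g ^+ m)%g | Negz m => (g ^- m.+1)%g end.

(* Positions, rows and columns are numbered from 0: k : 'I_(n ^ 2) stands for
   the position k + 1, so n(x-1) + y becomes n * x + y. *)
Lemma phi_subproof (n : nat) (x y : 'I_n) : n * x + y < n ^ 2.
Proof.
case: x y => x ltxn [y ltyn] /=; rewrite -mulnn.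
by apply: (@leq_trans (n * x.+1)); rewrite ?leq_mul2l ?ltxn ?orbT // mulnS addnC ltn_add2r.
Qed.

Definition phi (n : nat) (x y : 'I_n) : 'I_(n ^ 2) :=
  Ordinal (phi_subproof x y).

Lemma phi_inj (n : nat) (x y x' y' : 'I_n) :
  phi x y = phi x' y' -> x = x' /\ y = y'.
Proof.
move=> /(congr1 val) /= e.
have n_gt0 : 0 < n by apply: leq_ltn_trans (ltn_ord x).
split; apply/val_inj.
  have := congr1 (divn^~ n) e.
  by rewrite /= ![n * _]mulnC !divnMDl // !divn_small // !addn0.
have := congr1 (modn^~ n) e.
by rewrite /= ![n * _]mulnC !modnMDl !modn_small.
Qed.

Local Open Scope group_scope.

(* phi(n,i), phi(n-1,i), ..., phi(1,i) *)
Definition column_seq (n : nat) (i : 'I_n) : seq 'I_(n ^ 2) :=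
  [seq phi x i | x <- rev (enum 'I_n)].

(* phi(i,n), phi(i,n-1), ..., phi(i,1) *)
Definition row_seq (n : nat) (i : 'I_n) : seq 'I_(n ^ 2) :=
  [seq phi i y | y <- rev (enum 'I_n)].

Lemma column_uniq (n : nat) (i : 'I_n) : uniq (column_seq i).
Proof.
by rewrite map_inj_uniq ?rev_uniq ?enum_uniq // => x x' /phi_inj[].
Qed.

Lemma row_uniq (n : nat) (i : 'I_n) : uniq (row_seq i).
Proof.
by rewrite map_inj_uniq ?rev_uniq ?enum_uniq // => y y' /phi_inj[].
Qed.

Definition V (n : nat) (i : 'I_n) (j : int) : 'S_(n ^ 2) :=
  zexpg (cycle_perm (column_uniq i)) j.

Definition H (n : nat) (i : 'I_n) (j : int) : 'S_(n ^ 2) :=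
  zexpg (cycle_perm (row_uniq i)) j.

(* All V_i^j and H_i^j with j an arbitrary integer (see magic_movesP): the
   integer powers of g form the cyclic group <[g]>. *)
Definition magic_moves (n : nat) : {set 'S_(n ^ 2)} :=
  \bigcup_(i < n) (<[V i (Posz 1)]> :|: <[H i (Posz 1)]>).

(* The finite compositions of moves (see magic_groupP); in MathComp the
   product s * t of permutations is "s, then t". *)
Definition magic_group (n : nat) : {group 'S_(n ^ 2)} :=
  <<magic_moves n>>%G.

Lemma cycle_zexpgP (gT : finGroupType) (g h : gT) :
  h \in <[g]> <-> exists j : int, h = zexpg g j.
Proof.
split=> [/cycleP[m ->]|[[m|m] ->]]; first by exists (Posz m).
  exact: mem_cycle.
by rewrite /= groupV mem_cycle.
Qed.

Lemma magic_movesP (n : nat) (g : 'S_(n ^ 2)) :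
  g \in magic_moves n <->
  exists (i : 'I_n) (j : int), g = V i j \/ g = H i j.
Proof.
split=> [/bigcupP[i _]|[i [j g_ij]]].
  rewrite in_setU => /orP[] /cycle_zexpgP[j ->]; exists i, j; [left | right];
    by rewrite /V /H /= expg1.
apply/bigcupP; exists i => //; rewrite in_setU /V /H /= !expg1.
by apply/orP; case: g_ij => ->; [left | right]; apply/cycle_zexpgP; exists j.
Qed.

Lemma magic_groupP (n : nat) (g : 'S_(n ^ 2)) :
  g \in magic_group n <->
  exists2 s : seq 'S_(n ^ 2),
    (forall m, m \in s -> exists (i : 'I_n) (j : int), m = V i j \/ m = H i j)
    & g = \prod_(m <- s) m.
Proof.
split=> [/gen_prodgP[k [c cP ->]]|[s sP ->]].
  exists [seq c i | i <- enum 'I_k]; last by rewrite big_map enumT -/(index_enum _).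
  by move=> m /mapP[i _ ->]; apply/magic_movesP.
rewrite big_seq; apply: group_prod => m /sP/magic_movesP.
exact: mem_gen.
Qed.

(* Main.v *)
Require Import Defs.
From mathcomp Require Import all_boot all_fingroup all_solvable all_algebra.

Set Implicit Arguments.
Unset Strict Implicit.
Unset Printing Implicit Defensive.

(** A row and a column meet in exactly one position [p], so the commutator of
the two shifts is a 3-cycle through [p] and its images under the two shifts
([commutator_one_common_point]).  Call two points linked when some 3-cycle of
the group passes through both.  Conjugating one 3-cycle by another shows that
being linked is transitive ([linked_trans]).  Hence all positions of one line
are linked, and any two positions are linked through the corner that one
vertical and one horizontal segment share.  As soon as all points are linked,
conjugation again produces every 3-cycle ([linked_cycle3]), and 3-cycles
generate the alternating group ([Alt_sub_linked]).

The magic group therefore contains the alternating group, and it remains to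
look at the parity of the generators, which are cycles of length [n]
([odd_cycle_perm]).  For [n] odd they are all even and the group is alternating;
for [n] even they are odd and the group is symmetric. *)

Local Open Scope group_scope.

(** * Parity of a cycle *)

Section CycleParity.

Variable T : finType.

(** The path [w :: s] is closed up by an arrow back to [x] on one side and to [y]
on the other; every other arrow avoids both points.  The last hypothesis excludes
[z = y] off the path: [next_at] then returns [z], which the transposition would
move. *)
Lemma next_at_tperm (x y z w : T) (s : seq T) :
    x \notin s -> y \notin s -> z != x -> (z == y -> z == w) ->
  next_at z x w s = tperm x y (next_at z y w s).
Proof.
elim: s w => [|w' s IHs] w /=; rewrite ?inE ?negb_or.
  move=> _ _ zx zyw; case: (eqVneq z w) => [_|zw]; first by rewrite tpermR.
  rewrite tpermD //; first by rewrite eq_sym.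
  by apply: contraNneq zw => yz; apply: zyw; rewrite yz.
move=> /andP[xw' xs] /andP[yw' ys] zx zyw; case: (eqVneq z w) => [_|zw].
  by rewrite tpermD.
apply: IHs => // zy; case/negP: zw; exact: zyw.
Qed.

(** Splicing [x] in front of [y] redirects to [x] the arrow that entered [y]. *)
Lemma cycle_perm_cons (x y : T) (s : seq T)
    (Uxys : uniq (x :: y :: s)) (Uys : uniq (y :: s)) :
  cycle_perm Uxys = cycle_perm Uys * tperm x y.
Proof.
have := Uxys; rewrite /= inE negb_or => /andP[/andP[xy xs] /andP[ys _]].
apply/permP=> z; rewrite permM [cycle_perm Uxys z]permE [cycle_perm Uys z]permE /= -/(next (y :: s) z).
case: (eqVneq z x) => [->|zx].
  suff -> : next (y :: s) x = x by rewrite tpermL.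
  by rewrite next_nth inE (negPf xy) (negPf xs).
by apply: next_at_tperm => // /eqP->.
Qed.

Lemma odd_cycle_perm (s : seq T) (Us : uniq s) :
  odd_perm (cycle_perm Us) = odd (size s).-1.
Proof.
elim: s Us => [|x [|y s] IHs] Us.
- suff -> : cycle_perm Us = 1 by rewrite odd_perm1.
  by apply/permP=> z; rewrite !permE.
- suff -> : cycle_perm Us = 1 by rewrite odd_perm1.
  by apply/permP=> z; rewrite !permE /=; case: eqVneq.
have [/= /andP[xys _] Uys] := (Us, subseq_uniq (subseq_cons (y :: s) x) Us).
rewrite (cycle_perm_cons Us Uys) odd_permM IHs odd_tperm.
by move: xys; rewrite inE negb_or => /andP[-> _]; rewrite addbT.
Qed.

End CycleParity.

(** * Three-cycles and the alternating group *)

Section ThreeCycles.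

Variable T : finType.
Implicit Types (x y z : T) (s t : {perm T}) (G : {group {perm T}}).

(** For distinct points this is the 3-cycle [x |-> y |-> z |-> x]. *)
Definition cycle3 x y z : {perm T} := tperm x y * tperm x z.

Lemma cycle3J x y z s : cycle3 x y z ^ s = cycle3 (s x) (s y) (s z).
Proof. by rewrite conjMg !tpermJ. Qed.

Lemma cycle3V x y z : (cycle3 x y z)^-1 = cycle3 x z y.
Proof. by rewrite invMg !tpermV. Qed.

Lemma cycle3_rot x y z : z != x -> z != y -> cycle3 x y z = cycle3 y z x.
Proof.
move=> zx zy; rewrite /cycle3 conjgCV tpermV tpermJ tpermL tpermD 1?eq_sym //.
by rewrite [tperm y x]tpermC.
Qed.

Lemma cycle3E1 x y z : y != x -> y != z -> cycle3 x y z x = y.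
Proof. by move=> yx yz; rewrite permM tpermL tpermD // eq_sym. Qed.

Lemma cycle3E2 x y z : cycle3 x y z y = z.
Proof. by rewrite permM tpermR tpermL. Qed.

Lemma cycle3E3 x y z : z != x -> z != y -> cycle3 x y z z = x.
Proof. by move=> zx zy; rewrite permM (@tpermD _ x y) 1?eq_sym // tpermR. Qed.

Lemma cycle3D x y z u : u != x -> u != y -> u != z -> cycle3 x y z u = u.
Proof. by move=> ux uy uz; rewrite permM (@tpermD _ x y) ?tpermD // eq_sym. Qed.

(** The commutator sends [p] to [t p], then to [s p], and back to [p].  Any other
point is met by at most one of [s] and [t] along its path, whose inverse undoes
the move. *)
Lemma commutator_one_common_point s t p :
    s p != p -> t p != p -> (forall x, x != p -> s x = x \/ t x = x) ->
  [~ s, t] = cycle3 p (t p) (s p).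
Proof.
move=> sp tp disj.
have fix_s x : x != p -> t x != x -> s x = x by move=> /disj[// | ->]; rewrite eqxx.
have fix_t x : x != p -> s x != x -> t x = x by move=> /disj[-> | //]; rewrite eqxx.
have stp : s (t p) = t p by apply: fix_s; rewrite // (inj_eq perm_inj).
have tsp : t (s p) = s p by apply: fix_t; rewrite // (inj_eq perm_inj).
have st_neq : s p != t p.
  by apply: contraNneq sp => e; rewrite -(inj_eq (@perm_inj _ s)) e stp.
(* It is easier to compare t * s * [~ s, t] = s * t, which has no inverses. *)
suff e : s * t = t * s * cycle3 p (t p) (s p).
  by rewrite commgEl conjgE; apply: (mulgI (t * s)); rewrite -e !mulgA mulgK mulgV mul1g.
apply/permP=> x; rewrite [in LHS]permM 2![in RHS]permM.
case: (eqVneq x p) => [->|xp]; first by rewrite tsp stp cycle3E2.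
case: (eqVneq (s x) x) => [sx|sx]; last first.
  rewrite (fix_t x xp sx).
  case: (eqVneq (s x) p) => [->|sxp]; first by rewrite cycle3E1 // eq_sym.
  have tsx : t (s x) = s x by apply: fix_t; rewrite ?(inj_eq perm_inj).
  rewrite tsx cycle3D // ?(inj_eq perm_inj) //.
  by apply: contraNneq sxp => e; rewrite -(inj_eq (@perm_inj _ t)) tsx e.
rewrite sx; case: (eqVneq (t x) p) => [->|txp].
  by rewrite cycle3E3.
have stx : s (t x) = t x.
  case: (eqVneq (t x) x) => [->//|tx].
  by apply: fix_s; rewrite ?(inj_eq perm_inj).
rewrite stx cycle3D // ?(inj_eq perm_inj) //.
by apply: contraNneq txp => e; rewrite -(inj_eq (@perm_inj _ s)) stx e.
Qed.

Definition linked G x y : Prop :=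
  x = y \/ exists z, [/\ y != x, z != x, z != y & cycle3 x y z \in G].

Lemma linked_sym G x y : linked G x y -> linked G y x.
Proof.
case=> [->|[z [yx zx zy Gc]]]; [by left | right; exists z].
by split; rewrite // 1?eq_sym // -groupV cycle3V -cycle3_rot.
Qed.

(** The 3-cycle [(y z b)] carries [(x y a)] to a 3-cycle through [x] and [z],
unless [b = x], in which case [(y z b)] itself passes through [x] and [z]. *)
Lemma linked_trans G x y z : linked G x y -> linked G y z -> linked G x z.
Proof.
move=> [-> //|[a [yx ax ay Ga]]] [<-|[b [zy bz_ bz Gb]]].
  by right; exists a.
case: (eqVneq z x) => [->|zx]; first by left.
right; case: (eqVneq b x) => [bx|bx].
  exists y; split; rewrite // 1?eq_sym // -cycle3V groupV.
  by rewrite cycle3_rot // -bx.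
set g := cycle3 y z b in Gb.
have gx : g x = x by apply: cycle3D; rewrite eq_sym.
have gy : g y = z by apply: cycle3E1; rewrite // eq_sym.
exists (g a); rewrite zx -{1}gx -gy !(inj_eq perm_inj) ax ay; split=> //.
by rewrite -{1}gx -cycle3J groupJ.
Qed.

(** Start from a 3-cycle [(x y a)] of the group and move [a] to [z] with a
3-cycle [h = (a z u)]; when [u] is [x] or [y], conjugation by the inverse of [h]
gives the inverse of [(x y z)] instead. *)
Lemma linked_cycle3 G x y z :
    (forall u v, linked G u v) -> y != x -> z != x -> z != y ->
  cycle3 x y z \in G.
Proof.
move=> Glink yx zx zy.
have [xy|[a [_ ax ay Ga]]] := Glink x y; first by rewrite xy eqxx in yx.
have [<- //|[u [za ua uz Gu]]] := Glink a z.
set h := cycle3 a z u in Gu.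
have ha : h a = z by apply: cycle3E1; rewrite // eq_sym.
have hz : h z = u by apply: cycle3E2.
have hu : h u = a by apply: cycle3E3.
have hVu : h^-1 u = z by rewrite -hz permK.
have hVa : h^-1 a = u by rewrite -hu permK.
have hD v : v != a -> v != z -> v != u -> h v = v by apply: cycle3D.
have hVD v : v != a -> v != z -> v != u -> h^-1 v = v.
  by move=> va vz vu; rewrite -{1}(hD v) // permK.
case: (eqVneq u x) => [ux|ux].
  rewrite -groupV cycle3V cycle3_rot // 1?eq_sym //.
  have <- : cycle3 x y a ^ h^-1 = cycle3 z y x.
    by rewrite cycle3J -{1}ux hVu hVa (hVD y) ?ux // eq_sym.
  by rewrite groupJ ?groupV.
case: (eqVneq u y) => [uy|uy].
  rewrite -groupV cycle3V.
  have <- : cycle3 x y a ^ h^-1 = cycle3 x z y.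
    by rewrite cycle3J -{1}uy hVu hVa (hVD x) ?uy // eq_sym.
  by rewrite groupJ ?groupV.
have <- : cycle3 x y a ^ h = cycle3 x y z.
  by rewrite cycle3J ha !hD // eq_sym.
exact: groupJ.
Qed.

(** When [x] and [z] differ, inserting [(x z)(x z)] turns the product into
[(x y)(x z)] times [(z x)(z w)], two products of transpositions with a common
point. *)
Lemma linked_tperm2 G x y z w :
  (forall u v, linked G u v) -> x != y -> z != w ->
  tperm x y * tperm z w \in G.
Proof.
move=> Glink.
have Gc a b c : a != b -> a != c -> cycle3 a b c \in G.
  move=> ab ac; case: (eqVneq c b) => [->|cb]; first by rewrite /cycle3 tperm2 group1.
  by apply: linked_cycle3; rewrite // eq_sym.
move=> xy zw; case: (eqVneq x z) => [<-|xz] in zw *; first exact: Gc.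
have -> : tperm x y * tperm z w = cycle3 x y z * cycle3 z x w.
  by rewrite /cycle3 (tpermC z x) mulgA -(mulgA (tperm x y)) tperm2 mulg1.
by rewrite groupM ?Gc // eq_sym.
Qed.

Lemma Alt_sub_linked G : (forall x y, linked G x y) -> 'Alt_T \subset G.
Proof.
move=> Glink; apply/subsetP=> s; rewrite Alt_even.
have [ts -> dts] := prod_tpermP s; rewrite odd_perm_prod // => even_ts.
(* Evenness lets the transpositions be consumed two at a time. *)
have: size ts = (size ts)./2.*2 by rewrite even_halfK.
move: (size ts)./2 => k; elim: k ts dts {even_ts} => [|k IHk] [|t1 [|t2 ts]] //=.
  by rewrite big_nil group1.
move=> /and3P[dt1 dt2 dts] [size_ts]; rewrite !big_cons mulgA groupM ?IHk //.
exact: linked_tperm2.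
Qed.

(** Iterating the cycle from [x] reaches [y], and linkage is transitive. *)
Lemma linked_cycle G (s : seq T) (Us : uniq s) :
    (forall x, x \in s -> linked G x (cycle_perm Us x)) ->
  {in s &, forall x y, linked G x y}.
Proof.
move=> Gs x y xs ys.
have : fconnect (next s) x y by rewrite (fconnect_cycle (cycle_next Us)).
move=> /iter_findex <-; elim: (findex _ _ _) => [|k IHk]; first by left.
apply: linked_trans IHk _; rewrite iterS.
have: iter k (next s) x \in s by elim: k => //= k; rewrite mem_next.
by move=> /Gs; rewrite permE.
Qed.

Lemma cycle_perm_moves (s : seq T) (Us : uniq s) x :
  x \in s -> 1 < size s -> cycle_perm Us x != x.
Proof.
move=> xs s_gt1; rewrite permE.
have [i p sE] := rot_to xs.
have Up : uniq (x :: p) by rewrite -sE rot_uniq.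
rewrite -(next_rot i Us) sE; case: p {sE Up}(sE) Up => [|y p] sE /=.
  by move: s_gt1; rewrite -(size_rot i) sE.
by rewrite eqxx inE negb_or => /andP[/andP[xy _] _]; rewrite eq_sym.
Qed.

Lemma cycle_perm_out (s : seq T) (Us : uniq s) x :
  x \notin s -> cycle_perm Us x = x.
Proof. by move=> xs; rewrite permE next_nth (negPf xs). Qed.

End ThreeCycles.

(** * The magic group *)

Section Magic.

Variable n : nat.
Implicit Types i j : 'I_n.

Lemma phi_surj (k : 'I_(n ^ 2)) : exists i j, k = phi i j.
Proof.
have n_gt0 : 0 < n by case: n k => [[]|].
have lt_div : k %/ n < n by rewrite ltn_divLR // mulnn.
exists (Ordinal lt_div), (Ordinal (ltn_pmod k n_gt0)).
by apply: val_inj; rewrite /= mulnC -divn_eq.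
Qed.

Lemma mem_column_seq i j k : (phi i j \in column_seq k) = (j == k).
Proof.
apply/mapP/eqP => [[x _ /phi_inj[]] // | <-].
by exists i; rewrite // mem_rev mem_enum.
Qed.

Lemma mem_row_seq i j k : (phi i j \in row_seq k) = (i == k).
Proof.
apply/mapP/eqP => [[x _ /phi_inj[]] // | <-].
by exists j; rewrite // mem_rev mem_enum.
Qed.

Lemma size_column_seq i : size (column_seq i) = n.
Proof. by rewrite size_map size_rev size_enum_ord. Qed.

Lemma size_row_seq i : size (row_seq i) = n.
Proof. by rewrite size_map size_rev size_enum_ord. Qed.

Local Notation v i := (cycle_perm (column_uniq i)).
Local Notation h i := (cycle_perm (row_uniq i)).

Lemma column_in_magic i : v i \in magic_group n.
Proof. by apply/mem_gen/magic_movesP; exists i, (Posz 1); left. Qed.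

Lemma row_in_magic i : h i \in magic_group n.
Proof. by apply/mem_gen/magic_movesP; exists i, (Posz 1); right. Qed.

Hypothesis n_gt1 : 1 < n.

(** The column and the row through [p] have no other position in common, so the
commutator of their shifts is a 3-cycle through [p] and both of its images. *)
Lemma magic_linked_shifts i j (p := phi i j) :
  linked (magic_group n) p (v j p) /\ linked (magic_group n) p (h i p).
Proof.
have vp : v j p != p by rewrite cycle_perm_moves ?mem_column_seq ?size_column_seq.
have hp : h i p != p by rewrite cycle_perm_moves ?mem_row_seq ?size_row_seq.
have meet x : x != p -> v j x = x \/ h i x = x.
  have [i' [j' ->]] := phi_surj x => neq.
  case: (eqVneq j' j) => [jj|jj]; last first.
    by left; rewrite cycle_perm_out ?mem_column_seq.
  right; rewrite cycle_perm_out ?mem_row_seq //.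
  by apply: contraNneq neq => ->; rewrite jj.
have hv : h i p != v j p.
  have hh : h i (h i p) != h i p by rewrite (inj_eq perm_inj).
  have vv : v j (v j p) != v j p by rewrite (inj_eq perm_inj).
  apply/eqP=> e; have [ve|he] := meet _ hp.
    by rewrite -e ve eqxx in vv.
  by rewrite he eqxx in hh.
have := commutator_one_common_point vp hp meet.
have [Gv Gh] := (column_in_magic j, row_in_magic i).
move=> e; have := groupR Gv Gh; rewrite e => Gc.
split; right; last by exists (v j p); rewrite 1?eq_sym //; split; rewrite // eq_sym.
by exists (h i p); split; rewrite // -cycle3V groupV.
Qed.

(** The corner [phi i' j] lies in the column of [x] and in the row of [y]. *)
Lemma magic_linked x y : linked (magic_group n) x y.
Proof.
have [i [j ->]] := phi_surj x; have [i' [j' ->]] := phi_surj y.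
apply: (@linked_trans _ _ _ (phi i' j)).
  apply: (@linked_cycle _ _ _ (column_uniq j)); rewrite ?mem_column_seq //.
  move=> p; have [i1 [j1 ->]] := phi_surj p; rewrite mem_column_seq => /eqP->.
  by case: (magic_linked_shifts i1 j).
apply: (@linked_cycle _ _ _ (row_uniq i')); rewrite ?mem_row_seq //.
move=> p; have [i1 [j1 ->]] := phi_surj p; rewrite mem_row_seq => /eqP->.
by case: (magic_linked_shifts i' j1).
Qed.

Lemma Alt_sub_magic : 'Alt_('I_(n ^ 2)) \subset magic_group n.
Proof. exact: Alt_sub_linked magic_linked. Qed.

Lemma magic_odd : odd n -> magic_group n = 'Alt_('I_(n ^ 2)) :> {set _}.
Proof.
move=> n_odd; apply/eqP; rewrite eqEsubset Alt_sub_magic andbT gen_subG.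
have even_n1 : ~~ odd n.-1 by case: (n) n_odd.
apply/bigcupsP=> i _; rewrite subUset !cycle_subG /V /H /= !expg1 !Alt_even.
by rewrite !odd_cycle_perm size_column_seq size_row_seq even_n1.
Qed.

(** Multiplying by one odd shift turns every odd permutation into an even one. *)
Lemma magic_even : ~~ odd n -> magic_group n = [set: 'S_(n ^ 2)] :> {set _}.
Proof.
move=> n_even; apply/setP=> s; rewrite inE.
pose c := v (Ordinal n_gt1).
have odd_c : odd_perm c.
  by rewrite odd_cycle_perm size_column_seq; case: (n) n_gt1 n_even => //= m _; rewrite negbK.
have sub := subsetP Alt_sub_magic.
case: (boolP (odd_perm s)) => odd_s; last by rewrite sub // Alt_even.
rewrite -(groupMr _ (column_in_magic (Ordinal n_gt1))) sub // Alt_even.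
by rewrite odd_permM odd_s odd_c.
Qed.

End Magic.

Local Close Scope group_scope.

Theorem theorem3p4 (n : nat) (hn : 2 <= n) :
  #|magic_group n| = (if odd n then (n ^ 2)`! %/ 2 else (n ^ 2)`!).
Proof.
case: ifPn => [n_odd|n_even].
  rewrite magic_odd // -[n ^ 2 in RHS]card_ord -card_Alt ?mulKn // card_ord.
  exact: leq_trans (leq_pexp2l (ltnW hn) (isT : 1 <= 2)).
by rewrite magic_even // cardsT card_Sn.
Qed.
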